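(* Let $n$ be a positive integer, and let $m_1,\dots,m_{n+1}\in\mathbb R$ satisfy $\prod_{j=1}^{n+1}m_j\ne0$ and $\sum_{j=1}^{n+1}m_j\ne0$. Let $z_1,\dots,z_{n+1}\in\mathbb T=\{z\in\mathbb C:|z|=1\}$ be distinct, let $a_1,\dots,a_n$ denote the zeros (counted with multiplicity) of $F(z)=\sum_{j=1}^{n+1}\frac{m_j}{z-z_j}$, and let $\lambda=(-1)^n\prod_{j=1}^{n+1}z_j\in\mathbb T$. Then each of the points $z=z_1,\dots,z_{n+1}$ satisfies the Möbius-product equation $$z\prod_{j=1}^{n}\frac{z-a_j}{1-\overline{a_j}z}=\lambda.$$ *)

(* Defs.v *)
From HB Require Import structures.
From mathcomp Require Import all_boot all_order all_algebra.
From mathcomp Require Import reals complex.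

Set Implicit Arguments.
Unset Strict Implicit.
Unset Printing Implicit Defensive.

Import Order.TTheory GRing.Theory Num.Theory.
Local Open Scope ring_scope.
Local Open Scope complex_scope.

Local Notation "x %:F" := (@FracField.tofrac _ x).

(* Rational functions over [K] are elements of [{fraction {poly K}}].  Since
   [k] is a natural number and [q] does not vanish at [w], a pole of [f] has no
   order in this sense; order [0] means that [f] is defined and nonzero at
   [w]. *)
Definition has_zero_order (K : fieldType) (f : {fraction {poly K}}) (w : K)
    (k : nat) : Prop :=
  exists p q : {poly K},
    [/\ p.[w] != 0, q.[w] != 0 & f = (('X - w%:P) ^+ k * p)%:F / q%:F].

(* [a] lists all the zeros of [f] (poles are never zeros), each one repeated
   according to its multiplicity. *)
Definition lists_zeros (K : fieldType) (n : nat) (f : {fraction {poly K}})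
    (a : 'I_n -> K) : Prop :=
  forall (w : K) (k : nat), (0 < k)%N ->
    (has_zero_order f w k <-> #|[set j | a j == w]| = k).

Definition partial_fractions (R : realType) (n : nat) (m : 'I_n -> R)
    (z : 'I_n -> R[i]) : {fraction {poly R[i]}} :=
  \sum_(j < n) ((m j)%:C%:P)%:F / ('X - (z j)%:P)%:F.

(* Main.v *)
(** With [Q] the product of the [X - z_j], write the rational function as
    [P / Q].  Then [P] has degree [n], leading coefficient [M], the sum of the
    [m_j], and zeros [a_j], so that evaluating at a pole [z_k] gives
    [M * prod_j (z_k - a_j) = m_k * prod_(i != k) (z_k - z_i)].
    On the unit circle [1 - conj a * z_k = z_k * conj (z_k - a)], hence the
    Möbius product is, up to a power of [z_k], the quotient of
    [prod_j (z_k - a_j)] by its conjugate.  The real factor [m_k / M] cancels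
    in this quotient, and [(z_k - z_i) / conj (z_k - z_i) = - z_k * z_i]. *)
Require Import Defs.
From HB Require Import structures.
From mathcomp Require Import all_boot all_order all_algebra.
From mathcomp Require Import reals complex.

Set Implicit Arguments.
Unset Strict Implicit.
Unset Printing Implicit Defensive.

Import Order.TTheory GRing.Theory Num.Theory.
Local Open Scope ring_scope.
Local Open Scope complex_scope.

Local Notation "x %:F" := (@FracField.tofrac _ x).

(** Positivity of [k] makes [w] a root of [P], hence not of [Q], so nothing cancels at [w]. For
    [k = 0] the equivalence would fail at the roots of [Q]. *)
Lemma has_zero_order_mup (K : fieldType) (P Q : {poly K}) (w : K) (k : nat) :
    P != 0 -> Q != 0 -> (root P w -> ~~ root Q w) -> (0 < k)%N ->
  has_zero_order (P%:F / Q%:F) w k <-> mup w P = k.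
Proof.
move=> P0 Q0 PQ k_gt0; split=> [[p [q [pw qw]]]|kE].
  have q0 : q != 0 by apply: contraNneq qw => ->; rewrite horner0.
  have p0 : p != 0 by apply: contraNneq pw => ->; rewrite horner0.
  move/eqP; rewrite eqr_div ?tofrac_eq0 // -!tofracM tofrac_eq => /eqP PqE.
  have Pw : root P w.
    suff: (P * q).[w] == 0 by rewrite hornerM mulf_eq0 (negPf qw) orbF.
    by rewrite PqE !hornerE subrr expr0n eqn0Ngt k_gt0 /= !mul0r.
  (* In [P * q = ('X - w%:P) ^+ k * p * Q] the factors [q], [p] and [Q] do not vanish at [w], so
     only [P] and the power contribute multiplicity. *)
  move/(congr1 (mup w)): PqE.
  by rewrite !mupMl ?PQ // mup_XsubCX eqxx.
have [l [p /implyP/(_ P0) pw PE]] := multiplicity_XsubC P w.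
have lE : l = k.
  by rewrite -kE PE mupMr ?pw // mup_XsubCX eqxx.
exists p, Q; split; rewrite -?rootE.
- exact: pw.
- by apply: PQ; rewrite -dvdp_XsubCl XsubC_dvd ?kE.
- by rewrite {1}PE lE [p * _]mulrC.
Qed.

(** [P] splits over [K], and its list of roots is a permutation of [a] because every [w] occurs
    equally often in both. *)
Lemma lists_zerosE (K : closedFieldType) (n : nat) (P Q : {poly K})
    (a : 'I_n -> K) :
    P != 0 -> Q != 0 -> (forall w, root P w -> ~~ root Q w) ->
    lists_zeros (P%:F / Q%:F) a ->
  P = lead_coef P *: \prod_(j < n) ('X - (a j)%:P).
Proof.
move=> P0 Q0 PQ az; have [s PE] := closed_field_poly_normal P.
rewrite {1}PE; congr (_ *: _).
have -> : \prod_(j < n) ('X - (a j)%:P) =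
    \prod_(w <- [seq a j | j <- enum 'I_n]) ('X - w%:P).
  by rewrite big_map big_enum.
apply: perm_big; apply/allP => w _ /=; apply/eqP.
have -> : count_mem w s = mup w P.
  by rewrite PE -mul_polyC mupMr ?mu_prod_XsubC // rootC lead_coef_eq0.
have -> : count_mem w [seq a j | j <- enum 'I_n] = #|[set j | a j == w]|.
  by rewrite count_map -size_filter cardE /enum_mem -filter_predI;
    congr size; apply: eq_filter => j /=; rewrite !inE ?andbT.
have azw k : (0 < k)%N -> mup w P = k <-> #|[set j | a j == w]| = k.
  by move=> k0; rewrite -az // has_zero_order_mup //; apply: PQ.
(* [azw] speaks of positive counts only: if either count is positive the two agree, and otherwise
   both are zero. *)
have [m0|] := posnP (mup w P); last by case/azw => /(_ erefl).
have [c0|/azw[_]] := posnP #|[set j | a j == w]|; first by rewrite m0 c0.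
exact.
Qed.

Section PartialFractions.

Variables (K : fieldType) (n : nat) (c z : 'I_n.+1 -> K).

Definition pf_denominator : {poly K} := \prod_i ('X - (z i)%:P).

Definition pf_numerator : {poly K} :=
  \sum_j c j *: \prod_(i | i != j) ('X - (z i)%:P).

Lemma pf_denominator_neq0 : pf_denominator != 0.
Proof. exact/monic_neq0/monic_prod_XsubC. Qed.

Lemma sum_partial_fractions :
  \sum_j ((c j)%:P)%:F / ('X - (z j)%:P)%:F =
  pf_numerator%:F / pf_denominator%:F.
Proof.
rewrite rmorph_sum mulr_suml; apply: eq_bigr => j _.
apply/eqP; rewrite eqr_div ?tofrac_eq0 ?polyXsubC_eq0 ?pf_denominator_neq0 //.
rewrite -!tofracM tofrac_eq /pf_denominator (bigD1 j) //=.
by rewrite -mul_polyC mulrAC mulrA.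
Qed.

Lemma horner_pf_numerator k :
  pf_numerator.[z k] = c k * \prod_(i | i != k) (z k - z i).
Proof.
rewrite horner_sum (bigD1 k) //= [X in _ + X]big1 ?addr0 => [|j jk].
  by rewrite hornerZ horner_prod; under eq_bigr do rewrite hornerXsubC.
by rewrite hornerZ (bigD1 k) 1?eq_sym // hornerM hornerXsubC subrr mul0r mulr0.
Qed.

Lemma coef_pf_numerator : pf_numerator`_n = \sum_j c j.
Proof.
rewrite coef_sum; apply: eq_bigr => j _; rewrite coefZ.
set p := \prod_(i | _) _.
have pM : p \is monic by apply: monic_prod_XsubC.
have pn : n = (size p).-1.
  rewrite /p -big_filter size_prod_XsubC -sum1_size big_filter.
  by rewrite sum1_card cardC1 card_ord.
by rewrite [in p`_n]pn -lead_coefE (monicP pM) mulr1.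
Qed.

(** The value of the numerator at a pole is a nonzero coefficient times differences of distinct
    poles. *)
Lemma root_pf_numerator w : injective z -> (forall j, c j != 0) ->
  root pf_numerator w -> ~~ root pf_denominator w.
Proof.
move=> z_inj c0 Pw; apply/negP.
rewrite rootE horner_prod => /prodf_eq0[k _].
rewrite hornerXsubC subr_eq0 => /eqP wE.
move: Pw; rewrite wE rootE horner_pf_numerator mulf_eq0 (negPf (c0 k)) /=.
apply/negP/prodf_neq0 => i ik.
by rewrite subr_eq0 (inj_eq z_inj) eq_sym.
Qed.

End PartialFractions.

Section UnitCircle.

Variable R : rcfType.
Implicit Types u v w : R[i].

Lemma mul_conjc_circle u : `|u| = 1 -> u * u^* = 1.
Proof. by move=> u1; rewrite -sqr_normc u1 expr1n. Qed.

Lemma circle_neq0 u : `|u| = 1 -> u != 0.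
Proof. by move=> u1; rewrite -normr_eq0 u1 oner_neq0. Qed.

Lemma mobius_denominator u w : `|u| = 1 -> 1 - w^* * u = u * (u - w)^*.
Proof.
by move=> /mul_conjc_circle uu; rewrite rmorphB mulrBr uu [w^* * u]mulrC.
Qed.

(** This follows from [u^* = u^-1] and [v^* = v^-1]; the form without division also covers
    [u = v]. *)
Lemma circle_sub_conjc u v : `|u| = 1 -> `|v| = 1 ->
  u - v = - (u * v) * (u - v)^*.
Proof.
move=> /mul_conjc_circle uu /mul_conjc_circle vv.
by rewrite rmorphB mulNr mulrBr mulrAC uu -mulrA vv mul1r mulr1 opprB.
Qed.

End UnitCircle.

Theorem corollary3p2 (R : realType) (n : nat) (n_gt0 : (0 < n)%N)
    (m : 'I_n.+1 -> R)
    (prod_m : \prod_(j < n.+1) m j != 0) (sum_m : \sum_(j < n.+1) m j != 0)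
    (z : 'I_n.+1 -> R[i])
    (z_circle : forall j, `|z j| = 1) (z_inj : injective z)
    (a : 'I_n -> R[i]) (a_zeros : lists_zeros (partial_fractions m z) a)
    (lambda : R[i]) (lambdaE : lambda = (-1) ^+ n * \prod_(j < n.+1) z j) :
  forall k : 'I_n.+1,
    z k * \prod_(j < n) ((z k - a j) / (1 - (a j)^* * z k)) = lambda.
Proof.
move=> k; pose c j := (m j)%:C.
have c0 j : c j != 0.
  by rewrite eq_complex /= eqxx andbT; move/prodf_neq0: prod_m; apply.
set P := pf_numerator c z.
have Pzk : P.[z k] = c k * \prod_(i | i != k) (z k - z i).
  exact: horner_pf_numerator.
have D0 : \prod_(i | i != k) (z k - z i) != 0.
  by apply/prodf_neq0 => i ik; rewrite subr_eq0 (inj_eq z_inj) eq_sym.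
have P0 : P != 0.
  apply: contraNneq (mulf_neq0 (c0 k) D0) => PE.
  by rewrite -Pzk PE horner0.
have PE : P = lead_coef P *: \prod_(j < n) ('X - (a j)%:P).
  apply: (lists_zerosE P0 (pf_denominator_neq0 z)) => [w|].
    exact: root_pf_numerator.
  by rewrite -sum_partial_fractions.
(* The factorization [PE] has exactly [n] linear factors, so the leading coefficient is the
   coefficient of degree [n]. *)
have lcE : lead_coef P = (\sum_j m j)%:C.
  rewrite rmorph_sum -(coef_pf_numerator c z) -/P [in RHS]PE coefZ.
  set p := \prod_(j < n) _; have pM : p \is monic by apply: monic_prod_XsubC.
  have pn : n = (size p).-1.
    by rewrite size_prod_XsubC -sum1_size sum1_card card_ord.
  by rewrite [in p`_n]pn -lead_coefE (monicP pM) mulr1.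
have lc0 : lead_coef P != 0 by rewrite lead_coef_eq0.
set A := \prod_(j < n) (z k - a j).
set D := \prod_(i | i != k) (z k - z i) in Pzk D0.
have AE : lead_coef P * A = c k * D.
  rewrite -Pzk [in RHS]PE hornerZ horner_prod.
  by congr (_ * _); apply: eq_bigr => j _; rewrite hornerXsubC.
(* Conjugating [AE] fixes [lead_coef P] and [c k], which are real. *)
have AcE : lead_coef P * A^* = c k * D^*.
  rewrite lcE -[(\sum_j m j)%:C]conjc_real -[c k]conjc_real -!rmorphM.
  by rewrite -lcE AE.
have A0 : A != 0.
  by apply: contraNneq (mulf_neq0 (c0 k) D0) => A0; rewrite -AE A0 mulr0.
have cardk : #|[pred i | i != k]| = n by rewrite (cardC1 k) card_ord.
have DE : D = (- z k) ^+ n * (\prod_(i | i != k) z i) * D^*.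
  rewrite -[in (- _) ^+ n]cardk -prodr_const rmorph_prod -!big_split /=.
  by apply: eq_bigr => i _; rewrite mulNr -circle_sub_conjc.
(* By [AE] and [AcE], [A] and [D] differ by a real factor, so the relation [DE] passes from [D] to
   [A]. *)
have AAE : A = (- z k) ^+ n * (\prod_(i | i != k) z i) * A^*.
  by apply: (mulfI lc0); rewrite AE mulrCA AcE mulrCA -DE.
have denE : \prod_(j < n) (1 - (a j)^* * z k) = z k ^+ n * A^*.
  rewrite rmorph_prod -[in z k ^+ n](card_ord n) -prodr_const -big_split /=.
  by apply: eq_bigr => j _; rewrite mobius_denominator.
(* No [a j] equals [z k], so the Möbius denominators do not vanish and the division is genuine. *)
have zn0 : z k ^+ n * A^* != 0.
  rewrite mulf_eq0 expf_eq0 conjc_eq0 (negPf A0) orbF.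
  by rewrite (negPf (circle_neq0 _)) ?andbF.
(* After [A^*] cancels, [(- z k) ^+ n / z k ^+ n] leaves the sign [(-1) ^+ n], and the outer [z k]
   completes the product of the other poles. *)
rewrite big_split prodfV /= denE -/A lambdaE (bigD1 k) //= {1}AAE.
rewrite (exprNn (z k)) mulrA; apply: (canLR (mulfK zn0)).
by rewrite -!mulrA mulrCA; do 2!congr (_ * _); rewrite mulrCA.
Qed.
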